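(* Let $p$ be a prime number and let $\{b(n)\}_{n\ge 0}$ be a strictly increasing sequence of nonnegative integers with $b(0)=1$ such that $b(n)$ grows super-exponentially as $n\to\infty$. Suppose in addition that $a_0,a_1,a_2,\ldots$ are nonzero integers such that: (1) $p\mid a_0$; (2) there is some $i\ge 1$ such that $p\nmid a_i$; (3) there are constants $C,\kappa>1$ such that $|a_n|\le \kappa\cdot C^{b(n)}$ for all $n$. Then the power series $$f(x):=\sum_{n\ge 0}a_nx^{b(n)}\in\mathbb{Z}[[x]]$$ has a root $\lambda$ in $\{z\in\overline{\mathbb{Q}}_p : |z|_p<1\}$ that is transcendental over $\mathbb{Q}$, and $f(x)$ cannot be factored in $\mathbb{Z}[[x]]$ as a product of a polynomial in $\mathbb{Z}[x]$ and a unit of $\mathbb{Z}[[x]]$.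
   Context: A sequence $b(n)$ of positive integers grows super-exponentially if $b(n+1)/b(n)\to\infty$ as $n\to\infty$. Here $|\cdot|$ is the usual absolute value on $\mathbb{Q}$, $|\cdot|_p$ is the $p$-adic absolute value, extended uniquely to the algebraic closure $\overline{\mathbb{Q}}_p$ of $\mathbb{Q}_p$ (and to its completion $\mathbb{C}_p$). A power series with integer coefficients converges at every $z\in\overline{\mathbb{Q}}_p$ with $|z|_p<1$, and a root of $f$ is such a $z$ with $f(z)=0$. *)

(* Defs.v *)
From HB Require Import structures.
From mathcomp Require Import all_boot all_order all_algebra.
From mathcomp Require Import all_classical all_reals all_analysis.
From mathcomp Require Import ring lra zify.

Set Implicit Arguments.
Unset Strict Implicit.
Unset Printing Implicit Defensive.

Import Order.TTheory GRing.Theory Num.Theory.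
Import numFieldNormedType.Exports.

Local Open Scope ring_scope.
Local Open Scope classical_set_scope.
Local Open Scope quotient_scope.

Definition padic_norm (p : nat) (x : rat) : rat :=
  if x == 0 then 0
  else p%:R ^ ((logn p `|denq x|)%:Z - (logn p `|numq x|)%:Z).

Section PadicNorm.
Variables (p : nat) (p_pr : prime p).
Local Notation norm := (padic_norm p).

Let p0 : (p%:R : rat) != 0.
Proof. by rewrite pnatr_eq0 -lt0n prime_gt0. Qed.

Let p1 : 1 < (p%:R : rat).
Proof. by rewrite ltr1n prime_gt1. Qed.

Lemma padic_norm0 : norm 0 = 0. Proof. by rewrite /padic_norm eqxx. Qed.

Lemma padic_norm_ge0 x : 0 <= norm x.
Proof. by rewrite /padic_norm; case: ifP => // _; apply/exprz_ge0/ler0n. Qed.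

Lemma padic_norm_eq0 x : (norm x == 0) = (x == 0).
Proof.
rewrite /padic_norm; have [|x0] := eqVneq x 0; first by rewrite eqxx.
exact/negbTE/expfz_neq0.
Qed.

Lemma padic_norm_frac (m n : int) : m != 0 -> n != 0 ->
  norm (m%:~R / n%:~R) = p%:R ^ ((logn p `|n|)%:Z - (logn p `|m|)%:Z).
Proof.
move=> m0 n0; set x := _ / _.
have x0 : x != 0 by rewrite mulf_neq0 ?invr_eq0 ?intr_eq0.
rewrite /padic_norm (negbTE x0); congr (_ ^ _).
have : numq x * n = m * denq x.
  apply: (@intr_inj rat); rewrite !intrM numqE /x.
  by field; rewrite intr_eq0.
move/(congr1 absz); rewrite !abszM => /(congr1 (logn p)).
rewrite !lognM ?absz_gt0 ?denq_neq0 ?numq_eq0 //; lia.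
Qed.

Lemma padic_normM : {morph norm : x y / x * y}.
Proof.
move=> x y; have [->|x0] := eqVneq x 0; first by rewrite !(mul0r, padic_norm0).
have [->|y0] := eqVneq y 0; first by rewrite !(mulr0, padic_norm0).
rewrite -[in LHS](divq_num_den x) -[in LHS](divq_num_den y).
rewrite mulf_div -!intrM padic_norm_frac ?mulf_neq0 ?numq_eq0 ?denq_neq0 //.
rewrite /padic_norm (negbTE x0) (negbTE y0) -expfzDr // !abszM.
rewrite !lognM ?absz_gt0 ?denq_neq0 ?numq_eq0 //; congr (_ ^ _); lia.
Qed.

Lemma padic_norm1 : norm 1 = 1.
Proof.
have /eqP := padic_normM 1 1; rewrite mulr1 -subr_eq0 -{1}[norm 1]mulr1.
by rewrite -mulrBr mulf_eq0 padic_norm_eq0 oner_eq0 subr_eq0 => /eqP.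
Qed.

Lemma padic_normN x : norm (- x) = norm x.
Proof.
suff h : norm (-1) = 1 by rewrite -[- x]mulN1r padic_normM h mul1r.
have := padic_normM (-1) (-1); rewrite mulrNN mulr1 padic_norm1 => /esym/eqP.
rewrite -expr2 sqrf_eq1 => /orP[/eqP//|/eqP h].
by have := padic_norm_ge0 (-1); rewrite h oppr_ge0 ler10.
Qed.

Lemma padic_normV x : norm x^-1 = (norm x)^-1.
Proof.
have [->|x0] := eqVneq x 0; first by rewrite !(invr0, padic_norm0).
apply: (mulfI (_ : norm x != 0)); first by rewrite padic_norm_eq0.
by rewrite -padic_normM !mulfV ?padic_norm1 // padic_norm_eq0.
Qed.

Let le1 (k : int) : ((p%:R : rat) ^ k <= 1) = (k <= 0).
Proof. by rewrite -[X in _ <= X](expr0z (p%:R : rat)) ler_eXz2l. Qed.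

Let norm_add1 x : norm x <= 1 -> norm (1 + x) <= 1.
Proof.
have [->|x0] := eqVneq x 0; first by rewrite addr0 padic_norm1.
have [->|x1] := eqVneq (1 + x) 0; first by rewrite padic_norm0.
have d0 := denq_neq0 x.
have -> : 1 + x = (denq x + numq x)%:~R / (denq x)%:~R :> rat.
  by rewrite intrD mulrDl divq_num_den divff ?intr_eq0.
have s0 : denq x + numq x != 0.
  apply: contra_neq x1 => s.
  have /eqP : (1 + x) * (denq x)%:~R = 0 by rewrite mulrDl mul1r -numqE -intrD s.
  by rewrite mulf_eq0 intr_eq0 (negbTE d0) orbF => /eqP.
rewrite {1}/padic_norm (negbTE x0) padic_norm_frac // !le1.
rewrite !lerBlDr !add0r !lez_nat => le_dn.
have nz : numq x != 0 by rewrite numq_eq0.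
rewrite -pfactor_dvdn ?absz_gt0 //.
suff : ((p ^ logn p `|denq x|)%:Z %| denq x + numq x)%Z by rewrite dvdzE.
by apply: rpredD; rewrite dvdzE /= pfactor_dvdn ?absz_gt0.
Qed.

Lemma padic_normD x y : norm (x + y) <= Num.max (norm x) (norm y).
Proof.
wlog le_xy : x y / norm x <= norm y.
  move=> W; have /orP[h|h] := le_total (norm x) (norm y); first exact: W.
  by rewrite addrC maxC W.
rewrite le_max; apply/orP; right.
have [y0|y0] := eqVneq y 0.
  have : norm x == 0 by rewrite eq_le padic_norm_ge0 andbT -padic_norm0 -y0.
  by rewrite padic_norm_eq0 y0 => /eqP ->; rewrite addr0.
have -> : x + y = y * (1 + x / y) by field.
rewrite padic_normM ler_piMr ?padic_norm_ge0 // norm_add1 //.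
by rewrite padic_normM padic_normV ler_pdivrMr ?mul1r // lt_neqAle
  padic_norm_ge0 andbT eq_sym padic_norm_eq0.
Qed.

Lemma padic_normB x y : norm (x - y) = norm (y - x).
Proof. by rewrite -opprB padic_normN. Qed.

Lemma padic_normD_lt x y e : norm x < e -> norm y < e -> norm (x + y) < e.
Proof. by move=> xe ye; rewrite (le_lt_trans (padic_normD _ _)) // gt_max xe. Qed.

Lemma padic_norm_eq x y : norm (x - y) < norm x -> norm y = norm x.
Proof.
move=> h; apply/eqP; rewrite eq_le; apply/andP; split.
  rewrite -[y](subKr x) (le_trans (padic_normD _ _)) // padic_normN.
  by rewrite ge_max lexx ltW.
have := padic_normD (x - y) y; rewrite subrK le_max => /orP[|//].
by rewrite leNgt h.
Qed.

End PadicNorm.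

Definition padic_cauchy (p : nat) (u : nat -> rat) : Prop :=
  forall e : rat, 0 < e -> exists N : nat, forall m n : nat,
    (N <= m)%N -> (N <= n)%N -> padic_norm p (u m - u n) < e.

Definition padic_null (p : nat) (u : nat -> rat) : Prop :=
  forall e : rat, 0 < e -> exists N : nat, forall n : nat,
    (N <= n)%N -> padic_norm p (u n) < e.

Section CauchySequences.
Variables (p : nat) (p_pr : prime p).
Local Notation norm := (padic_norm p).

Lemma padic_cauchy_bounded u : padic_cauchy p u ->
  exists2 B, 0 < B & forall n, norm (u n) < B.
Proof.
move=> /(_ 1 ltr01)[N uN].
pose B := \sum_(i < N.+1) norm (u i) + 1.
have S0 m : 0 <= \sum_(i < m) norm (u i).
  by apply: sumr_ge0 => i _; exact: padic_norm_ge0.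
have leB k : (k <= N)%N -> norm (u k) < B.
  move=> kN; have kN' : (k < N.+1)%N by [].
  rewrite /B (bigD1 (Ordinal kN')) //= -addrA ltr_pwDr // ltr_wpDl //.
  by apply: sumr_ge0 => i _; exact: padic_norm_ge0.
exists B => [|n]; first by rewrite ltr_wpDl.
have [/leB//|Nn] := leqP n N.
rewrite -[u n](subrK (u N)) padic_normD_lt ?leB //.
by rewrite (lt_le_trans (uN _ _ (ltnW Nn) (leqnn _))) // lerDr.
Qed.

Definition padic_cauchy_pred : pred (nat -> rat) :=
  [pred u | `[< padic_cauchy p u >]].

(* The proof of primality is a (phantom) argument so that the ring structure
   can be inferred. *)
Definition padic_cauchy_mem of prime p := padic_cauchy_pred.

Lemma padic_cauchy_subring : subring_closed (padic_cauchy_mem p_pr).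
Proof.
split=> [|u v /asboolP cu /asboolP cv|u v /asboolP cu /asboolP cv].
- apply/asboolP => e e0; exists 0 => m n _ _.
  by rewrite [X in norm X](subrr (1 : rat)) padic_norm0.
- apply/asboolP => e e0.
  have [M uM] := cu e e0; have [N vN] := cv e e0.
  exists (maxn M N) => m n; rewrite !geq_max => /andP[Mm Nm] /andP[Mn Nn].
  have -> : (u - v) m - (u - v) n = (u m - u n) - (v m - v n).
    by rewrite !fctE; ring.
  by rewrite padic_normD_lt ?padic_normN ?uM ?vN.
- have [A A0 uA] := padic_cauchy_bounded cu.
  have [B B0 vB] := padic_cauchy_bounded cv.
  apply/asboolP => e e0.
  have [M uM] := cu (e / B) (divr_gt0 e0 B0).
  have [N vN] := cv (e / A) (divr_gt0 e0 A0).
  exists (maxn M N) => m n; rewrite !geq_max => /andP[Mm Nm] /andP[Mn Nn].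
  have -> : (u * v) m - (u * v) n = (u m - u n) * v m + u n * (v m - v n).
    by rewrite !fctE; ring.
  rewrite padic_normD_lt // padic_normM //.
    rewrite -[e](divfK (lt0r_neq0 B0)) ltr_pM ?padic_norm_ge0 ?uM //.
  rewrite mulrC -[e](divfK (lt0r_neq0 A0)) ltr_pM ?padic_norm_ge0 ?vN //.
Qed.

HB.instance Definition _ := GRing.isSubringClosed.Build (nat -> rat)
  (padic_cauchy_mem p_pr) padic_cauchy_subring.

Record cauchy_seq : Type := CauchySeq {
  cauchy_val :> nat -> rat;
  cauchy_valP : cauchy_val \in padic_cauchy_mem p_pr }.

HB.instance Definition _ := [isSub for cauchy_val].
HB.instance Definition _ := [Choice of cauchy_seq by <:].
HB.instance Definition _ := [SubChoice_isSubComNzRing of cauchy_seq by <:].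

Lemma cauchy_seqP (u : cauchy_seq) : padic_cauchy p u.
Proof. exact/asboolP/cauchy_valP. Qed.

Definition null_ideal : pred cauchy_seq := [pred u : cauchy_seq | `[< padic_null p u >]].

Lemma null_ideal_closed : idealr_closed null_ideal.
Proof.
split=> [||a u v /asboolP nu /asboolP nv].
- by apply/asboolP => e e0; exists 0 => n _; rewrite padic_norm0.
- apply/asboolP => /(_ 1 ltr01)[N /(_ N (leqnn _))].
  by rewrite padic_norm1 // ltxx.
- apply/asboolP => e e0.
  have [A A0 aA] := padic_cauchy_bounded (cauchy_seqP a).
  have [M uM] := nu (e / A) (divr_gt0 e0 A0); have [N vN] := nv e e0.
  exists (maxn M N) => n; rewrite geq_max => /andP[Mn Nn].
  rewrite padic_normD_lt ?vN // [norm _]padic_normM //.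
  rewrite mulrC -[e](divfK (lt0r_neq0 A0)) ltr_pM ?padic_norm_ge0 ?uM //.
Qed.

HB.instance Definition _ := isIdealr.Build cauchy_seq null_ideal null_ideal_closed.

(* Q_p as the completion of Q: Cauchy sequences modulo null sequences. *)
Definition Qp : Type := {ideal_quot (null_ideal : idealr cauchy_seq)}.

HB.instance Definition _ := GRing.ComNzRing.on Qp.

Lemma cauchy_norm_const (u : nat -> rat) : padic_cauchy p u -> ~ padic_null p u ->
  exists N, exists2 c, 0 < c & forall n, (N <= n)%N -> norm (u n) = c.
Proof.
move=> cu /existsNP[e] /not_implyP[e0] /forallNP nu.
have [N uN] := cu e e0.
have /existsNP[n0 /not_implyP[Nn0 /negP]] := nu N; rewrite -leNgt => le_e.
exists N, (norm (u n0)); first exact: lt_le_trans le_e.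
move=> n Nn; apply: padic_norm_eq => //.
exact: lt_le_trans (uN _ _ Nn0 Nn) le_e.
Qed.

Definition Qp_of : {rmorphism cauchy_seq -> Qp} :=
  \pi_{ideal_quot (null_ideal : idealr cauchy_seq)}.

Definition Qp_rep (x : Qp) : cauchy_seq := repr x.

Lemma Qp_repK : cancel Qp_rep Qp_of. Proof. exact: reprK. Qed.

Lemma Qp_eq (u v : cauchy_seq) : Qp_of u = Qp_of v <-> padic_null p (u - v).
Proof.
split=> [/eqP|h]; first by rewrite -Quotient.idealrBE => /asboolP.
by apply/eqP; rewrite -Quotient.idealrBE; apply/asboolP.
Qed.

Lemma Qp_eq0 (u : cauchy_seq) : Qp_of u = 0 <-> padic_null p u.
Proof. by rewrite -(rmorph0 Qp_of) Qp_eq subr0. Qed.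

Lemma Qp_inv_ex (x : Qp) : exists y : Qp, (x = 0 -> y = 0) /\ (x != 0 -> y * x = 1).
Proof.
have [->|x0] := eqVneq x 0; first by exists 0.
pose u := Qp_rep x.
have nu : ~ padic_null p u by move/Qp_eq0; rewrite Qp_repK; exact/eqP.
have cu := cauchy_seqP u.
have [N [c c0 uc]] := cauchy_norm_const cu nu.
pose v n := if (N <= n)%N then (u n)^-1 else 0.
have u0 n : (N <= n)%N -> u n != 0.
  by move=> Nn; rewrite -(padic_norm_eq0 p_pr) uc // lt0r_neq0.
have cv : v \in padic_cauchy_mem p_pr.
  apply/asboolP => e e0; have ecc0 : 0 < e * (c * c) by rewrite !mulr_gt0.
  have [M uM] := cu _ ecc0.
  exists (maxn M N) => m n; rewrite !geq_max => /andP[Mm Nm] /andP[Mn Nn].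
  rewrite /v Nm Nn.
  have -> : (u m)^-1 - (u n)^-1 = (u n - u m) / (u m * u n).
    by field; rewrite !u0.
  rewrite padic_normM // padic_normV // padic_normM // !uc //.
  by rewrite ltr_pdivrMr ?mulr_gt0 // uM.
exists (Qp_of (CauchySeq cv)); split=> [/eqP|_]; first by rewrite (negbTE x0).
rewrite -[x]Qp_repK -/u -rmorphM -(rmorph1 Qp_of); apply/Qp_eq => e e0.
exists N => n Nn; rewrite [X in norm X](_ : _ = 0) ?padic_norm0 //.
by rewrite /= !fctE /= /v Nn mulVf ?u0 // subrr.
Qed.

Definition Qp_inv (x : Qp) : Qp := projT1 (cid (Qp_inv_ex x)).

Lemma Qp_mulVf (x : Qp) : x != 0 -> Qp_inv x * x = 1.
Proof. by rewrite /Qp_inv; case: cid => y [] /=. Qed.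

Lemma Qp_inv0 : Qp_inv 0 = 0.
Proof. by rewrite /Qp_inv; case: cid => y [] /= ->. Qed.

HB.instance Definition _ := GRing.ComNzRing_isField.Build Qp Qp_mulVf Qp_inv0.

End CauchySequences.

Definition is_absolute_value (R : realType) (F : fieldType) (v : F -> R) : Prop :=
  [/\ forall x, 0 <= v x,
      forall x, v x = 0 <-> x = 0,
      forall x y, v (x * y) = v x * v y
    & forall x y, v (x + y) <= v x + v y].

(* The limit always exists and does not depend on the representative of x, by
   Qp_norm_cvg. *)
Definition Qp_norm (R : realType) (p : nat) (p_pr : prime p) (x : Qp p_pr) : R :=
  limn (fun n => ratr (padic_norm p (Qp_rep x n)) : R).

Section QpNorm.
Variables (R : realType) (p : nat) (p_pr : prime p).
Local Notation norm := (padic_norm p).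

Let ratr_dist (u v : nat -> rat) n :
  `|ratr (norm (u n)) - ratr (norm (v n)) : R| <= ratr (norm ((u - v) n)).
Proof.
have D x y : norm x - norm y <= norm (x - y).
  rewrite lerBlDr -[in leLHS](subrK y x) (le_trans (padic_normD p_pr _ _)) //.
  by rewrite ge_max lerDl lerDr !padic_norm_ge0.
rewrite -rmorphB /= ler_norml -rmorphN /= !ler_rat D andbT.
by rewrite lerNl opprB [(u - v) n]/= padic_normB // D.
Qed.

Let null_cvg (u : nat -> rat) :
  padic_null p u <-> (ratr (norm (u n)) : R) @[n --> \oo] --> (0 : R).
Proof.
have nn n : `|0 - ratr (norm (u n)) : R| = ratr (norm (u n)).
  by rewrite add0r normrN ger0_norm // ler0q padic_norm_ge0.
split=> [nu|/cvgrPdist_lt uc e e0].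
  apply/cvgrPdist_lt => e e0.
  have [q] := rat_in_itvoo e0; rewrite in_itv /= => /andP[q0 qe].
  rewrite ltr0q in q0; have [N uN] := nu q q0.
  exists N => // n /= Nn; rewrite nn (lt_trans _ qe) // ltr_rat uN //.
have [|N _ uN] := uc (ratr e); first by rewrite ltr0q.
by exists N => n /uN; rewrite nn ltr_rat.
Qed.

Lemma Qp_norm_cvg (u : cauchy_seq p_pr) :
  (ratr (norm (u n)) : R) @[n --> \oo] --> Qp_norm R (Qp_of p_pr u).
Proof.
set v := Qp_rep (Qp_of p_pr u).
have nuv : padic_null p (u - v) by apply/Qp_eq; rewrite Qp_repK.
have d0 : (ratr (norm (u n)) - ratr (norm (v n)) : R) @[n --> \oo] --> (0 : R).
  apply: norm_cvg0; have [/(_ nuv) h _] := null_cvg (u - v).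
  apply: (squeeze_cvgr _ (cvg_cst (0 : R)) h).
  by apply: nearW => n; rewrite normr_ge0 ratr_dist.
suff cv : cvgn (fun n => ratr (norm (v n)) : R).
  rewrite -[Qp_norm _ _]add0r.
  under eq_cvg => n do rewrite -[ratr _](subrK (ratr (norm (v n)))).
  exact: cvgD.
have [nv|nv] := pselect (padic_null p v).
  by apply/cvg_ex; exists 0; apply/null_cvg.
have [N [c _ vc]] := cauchy_norm_const p_pr (cauchy_seqP v) nv.
apply/cvg_ex; exists (ratr c : R); apply: cvg_near_cst.
by exists N => // n /= /vc ->.
Qed.

Lemma Qp_norm_absolute_value : is_absolute_value (@Qp_norm R p p_pr).
Proof.
have nc (x : Qp p_pr) := @Qp_norm_cvg (Qp_rep x).
split=> [x|x|x y|x y].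
- rewrite -[x]Qp_repK; apply: (cvgr_to_ge (nc x)).
  by apply: nearW => n; rewrite ler0q padic_norm_ge0.
- have := nc x; rewrite Qp_repK => ncx; rewrite -[x in X in _ <-> X]Qp_repK.
  rewrite Qp_eq0 null_cvg; split=> [<- //|h]; exact: (cvg_unique _ ncx h).
- have := @Qp_norm_cvg (Qp_rep x * Qp_rep y).
  rewrite rmorphM !Qp_repK => h; apply: (cvg_unique _ h) => //.
  have hx := nc x; have hy := nc y; rewrite !Qp_repK in hx hy.
  apply: cvg_trans (cvgM hx hy); apply: near_eq_cvg; apply: nearW => n /=.
  by rewrite -rmorphM -padic_normM.
- have := @Qp_norm_cvg (Qp_rep x + Qp_rep y).
  rewrite rmorphD !Qp_repK => h.
  have hx := nc x; have hy := nc y; rewrite !Qp_repK in hx hy.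
  apply: (ler_cvg_to h (cvgD hx hy)); apply: nearW => n.
  rewrite fctE -rmorphD /= ler_rat (le_trans (padic_normD p_pr _ _)) //.
  by rewrite ge_max lerDl lerDr !padic_norm_ge0.
Qed.

Let cauchy_int (n : int) k : (n%:~R : cauchy_seq p_pr) k = n%:~R.
Proof.
have add (u v : cauchy_seq p_pr) : (u + v) k = u k + v k by [].
have opp (u : cauchy_seq p_pr) : (- u) k = - u k by [].
have nat_case m : (m%:R : cauchy_seq p_pr) k = m%:R.
  by elim: m => // m IH; rewrite -addn1 !natrD add IH.
by case: n => m; rewrite ?NegzE ?mulrNz ?opp -!pmulrn nat_case.
Qed.

Lemma Qp_norm_rat (q : rat) : Qp_norm R (ratr q : Qp p_pr) = ratr (norm q).
Proof.
have [_ N0 NM _] := Qp_norm_absolute_value.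
have Nint (n : int) : Qp_norm R (n%:~R : Qp p_pr) = ratr (norm n%:~R).
  have := @Qp_norm_cvg n%:~R; rewrite rmorph_int => h.
  apply: (cvg_unique _ h) => //; apply: cvg_near_cst; apply: nearW => k.
  by rewrite cauchy_int.
have d0 : Qp_norm R ((denq q)%:~R : Qp p_pr) != 0.
  by rewrite Nint fmorph_eq0 padic_norm_eq0 // intr_eq0 denq_neq0.
have d0' : ((denq q)%:~R : Qp p_pr) != 0 by apply/eqP => /N0/eqP; apply/negP.
apply: (mulIf d0); rewrite -NM [in LHS]/ratr divfK // !Nint -rmorphM /=.
by rewrite -padic_normM // -numqE.
Qed.

End QpNorm.

(* A series in Z[[x]] is encoded by its sequence of coefficients. *)
Definition ps_mul (f g : nat -> int) : nat -> int :=
  fun n => \sum_(i < n.+1) f i * g (n - i)%N.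

Definition ps_one : nat -> int := fun n => (n == 0%N)%:R.

Definition ps_unit (f : nat -> int) : Prop := exists g, ps_mul f g = ps_one.

Definition ps_poly (P : {poly int}) : nat -> int := fun n => P`_n.

(* The series of the a n * x ^ (b n). For strictly increasing b, n <= b n, so only
   indices n <= k can contribute to the coefficient of x ^ k; see lacunaryE, lacunary0. *)
Definition lacunary (a : nat -> int) (b : nat -> nat) : nat -> int :=
  fun k => \sum_(n < k.+1 | b n == k) a n.

Lemma lacunaryE a b : {homo b : m n / (m < n)%N} -> forall n, lacunary a b (b n) = a n.
Proof.
move=> b_incr n; rewrite /lacunary.
have inj m k : b m = b k -> m = k.
  by case: (ltngtP m k) => // /b_incr; [move=> + e|move=> + e]; rewrite e ltnn.
have ge m : (m <= b m)%N by elim: m => // m /leq_ltn_trans; apply; exact: b_incr.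
rewrite (bigD1 (Ordinal (ge n : (n < (b n).+1)%N))) //= big1 ?addr0 // => i.
by move=> /andP[/eqP/inj e /eqP[]]; exact: val_inj.
Qed.

Lemma lacunary0 a b k : (forall n, b n != k) -> lacunary a b k = 0.
Proof. by move=> bk; rewrite /lacunary big1 // => i; rewrite (negbTE (bk i)). Qed.

(* K carries no topology: f(z) = s is convergence of the partial sums to s for the
   absolute value v. *)
Definition ps_converges (R : realType) (K : fieldType) (v : K -> R)
    (f : nat -> int) (z s : K) : Prop :=
  v (\sum_(k < n) (f k)%:~R * z ^+ k - s) @[n --> \oo] --> (0 : R).

Definition ps_root (R : realType) (K : fieldType) (v : K -> R)
    (f : nat -> int) (z : K) : Prop :=
  v z < 1 /\ ps_converges v f z 0.

Definition super_exponential (R : realType) (b : nat -> nat) : Prop :=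
  ((b n.+1)%:R / (b n)%:R : R) @[n --> \oo] --> +oo.

Definition transcendental (K : fieldType) (z : K) : Prop :=
  ~ algebraicOver (ratr : rat -> K) z.

(* Main.v *)
(* Write f = x g.  The coefficients of g below the index d = b(m) - 1 >= 1, with m
   least such that p does not divide a_m, are divisible by p, and the d-th is a
   p-adic unit; by Weierstrass preparation g is a monic polynomial of degree d over
   Z_p times a unit, so it has a root lambda with 0 < |lambda| < 1.  If lambda were
   algebraic over Q, the partial sum S_N(lambda) of f would be either zero or, by a
   Liouville bound, at least c^(-b(N)) in p-adic absolute value.  But it equals minus
   the tail of the series, hence is at most |lambda|^b(N+1), so that super-exponential
   growth forces S_N(lambda) = 0 for all large N; then
   a_N lambda^b(N) = S_N(lambda) - S_(N-1)(lambda) = 0, which is absurd.  If f were a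
   polynomial times a unit, lambda would be a root of the polynomial. *)
From HB Require Import structures.
Require Import Defs.
From mathcomp Require Import all_boot all_order all_algebra perm.
From mathcomp Require Import all_classical all_reals all_analysis.
From mathcomp Require Import ring lra zify.

Set Implicit Arguments.
Unset Strict Implicit.
Unset Printing Implicit Defensive.

Import Order.TTheory GRing.Theory Num.Theory.
Import numFieldNormedType.Exports.

Local Open Scope ring_scope.
Local Open Scope classical_set_scope.

(** * Determinants and resultants *)

(** Expanding the product of the row sums gives one nonnegative term for each map from rows to
    columns; the Leibniz formula uses only the permutations among these maps. *)
Lemma det_le_prod_row_norms (R : numDomainType) n (A : 'M[R]_n) :
  `|\det A| <= \prod_i \sum_j `|A i j|.
Proof.
rewrite bigA_distr_bigA /= (le_trans (ler_norm_sum _ _ _)) //.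
rewrite (eq_bigr (fun s : 'S_n => \prod_i `|A i (s i)|)); last first.
  by move=> s _; rewrite normrM normrX normrN1 expr1n mul1r normr_prod.
pose h (s : 'S_n) : {ffun 'I_n -> 'I_n} := finfun s.
have hinj : injective h.
  by move=> s t /ffunP e; apply/permP => i; have := e i; rewrite !ffunE.
under eq_bigr => s _.
  under eq_bigr => i _ do rewrite -[s i](ffunE s).
  over.
have -> : \sum_(s : 'S_n) \prod_(i < n) `|A i (finfun s i)|
    = \sum_(f in [set h s | s : 'S_n]%SET) \prod_(i < n) `|A i (f i)|.
  by rewrite big_imset //= => s t _ _; exact: hinj.
rewrite [leRHS](bigID (mem [set h s | s : 'S_n]%SET)) /= lerDl.
by apply: sumr_ge0 => f _; apply: prodr_ge0.
Qed.

Definition coef_norm (R : numDomainType) (p : {poly R}) := \sum_(i < size p) `|p`_i|.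

(** The summands are the entries of a row of a Sylvester matrix, as [Sylvester_mxE] writes them; the
    factor [(k <= j)] removes the spurious values of truncated subtraction. *)
Lemma sum_shifted_coef_le (R : numDomainType) (p : {poly R}) n k :
  \sum_(j < n) `|p`_(j - k) *+ (k <= j)%N| <= coef_norm p.
Proof.
have pre m : \sum_(j < m) `|p`_j| <= coef_norm p.
  have [mp|pm] := leqP m (size p).
    by rewrite /coef_norm (big_ord_widen _ (fun j => `|p`_j|) mp) big_mkcond;
      apply: ler_sum => i _; case: ifP.
  rewrite /coef_norm (big_ord_widen _ (fun j => `|p`_j|) (ltnW pm)) /=.
  rewrite [X in _ <= X]big_mkcond; apply: ler_sum => i _; case: ltnP => // pi.
  by rewrite nth_default // normr0.
have [nk|kn] := leqP n k.
  rewrite big1 ?sumr_ge0 // => j _.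
  by rewrite leqNgt (leq_trans (ltn_ord j) nk) mulr0n normr0.
rewrite -(big_mkord xpredT (fun j => `|p`_(j - k) *+ (k <= j)%N|)).
rewrite (big_cat_nat (n := k)) ?(ltnW kn) //= big_nat_cond big1 ?add0r; last first.
  by move=> i /andP[/andP[_ ik] _]; rewrite leqNgt ik mulr0n normr0.
rewrite -{1}[k]add0n big_addn big_mkord.
by under eq_bigr => i _ do rewrite addnK leq_addl mulr1n.
Qed.

Lemma resultant_le (R : numDomainType) (p q : {poly R}) :
  `|resultant p q| <= coef_norm p ^+ (size q).-1 * coef_norm q ^+ (size p).-1.
Proof.
rewrite /resultant (le_trans (det_le_prod_row_norms _)) // big_split_ord /=.
rewrite -[X in _ <= X * _](_ : \prod_(i < (size q).-1) coef_norm p = _);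
  last by rewrite prodr_const card_ord.
rewrite -[X in _ <= _ * X](_ : \prod_(i < (size p).-1) coef_norm q = _);
  last by rewrite prodr_const card_ord.
apply: ler_pM; rewrite ?prodr_ge0 //; first 2 last.
- apply: ler_prod => i _; rewrite sumr_ge0 //=.
  under eq_bigr => j _ do rewrite Sylvester_mxE (unsplitK (inl i)).
  exact: sum_shifted_coef_le.
- apply: ler_prod => i _; rewrite sumr_ge0 //=.
  under eq_bigr => j _ do rewrite Sylvester_mxE (unsplitK (inr i)).
  exact: sum_shifted_coef_le.
- by move=> i _; exact: sumr_ge0.
- by move=> i _; exact: sumr_ge0.
Qed.

(** * Ultrametric absolute values *)

(** If [t] were 1 + s with s > 0, Bernoulli's inequality for [t ^+ n], squared, would make
    [t ^+ (n * 2)] grow at least quadratically. *)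
Lemma expr_le_linear_le1 (R : realType) (t : R) :
  0 <= t -> (forall n, t ^+ n <= n.+1%:R) -> t <= 1.
Proof.
move=> t0 tn; rewrite leNgt; apply/negP => t1.
pose s := t - 1; have s0 : 0 < s by rewrite subr_gt0.
have bern n : n%:R * s <= t ^+ n.
  elim: n => [|n IH]; first by rewrite mul0r expr0.
  have t1n : 1 <= t ^+ n by rewrite exprn_ege1 // ltW.
  rewrite exprS -[t](subrK 1) -/s -natr1; rewrite -[t](subrK 1) -/s in IH t1n.
  nra.
(* With [n * s ^+ 2 > 3], the square of [n * s] exceeds [3 * n], which is at least [2 * n + 1]. *)
pose n := Num.bound (3 / s ^+ 2).
have n_gt : 3 / s ^+ 2 < n%:R by rewrite archi_boundP // divr_ge0 // sqr_ge0.
rewrite ltr_pdivrMr ?exprn_gt0 // in n_gt.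
have := tn (n * 2)%N; rewrite exprM => le_n.
have n1 : (1 : R) <= n%:R.
  by rewrite ler1n lt0n; apply: contraTneq n_gt => ->; rewrite mul0r -leNgt.
have := bern n; set N : R := n%:R in n_gt n1 le_n * => bn.
have sq : (N * s) ^+ 2 <= (t ^+ n) ^+ 2
  by rewrite lerXn2r // nnegrE ?exprn_ge0 // mulr_ge0 ?ler0n // ltW.
have e : (n * 2).+1%:R = 2 * N + 1 :> R by rewrite -natr1 natrM mulrC.
rewrite e in le_n; have := le_trans sq le_n; rewrite exprMn.
have : N * 3 < N * (N * s ^+ 2) by rewrite ltr_pM2l // (lt_le_trans ltr01).
lra.
Qed.

Section AbsoluteValue.
Variables (R : realType) (K : fieldType) (v : K -> R).
Hypothesis v_abs : is_absolute_value v.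

Lemma abs_ge0 x : 0 <= v x. Proof. by case: v_abs. Qed.

Lemma abs_eq0 x : (v x == 0) = (x == 0).
Proof. by have [_ v0 _ _] := v_abs; apply/eqP/eqP => /v0. Qed.

Lemma abs0 : v 0 = 0. Proof. by apply/eqP; rewrite abs_eq0. Qed.

Lemma abs_gt0 x : (0 < v x) = (x != 0).
Proof. by rewrite lt_neqAle abs_ge0 andbT eq_sym abs_eq0. Qed.

Lemma absM x y : v (x * y) = v x * v y. Proof. by case: v_abs. Qed.

Lemma abs1 : v 1 = 1.
Proof.
by apply: (mulfI (_ : v 1 != 0)); rewrite ?abs_eq0 ?oner_eq0 // -absM !mulr1.
Qed.

Lemma absN x : v (- x) = v x.
Proof.
apply/eqP; rewrite -(@eqrXn2 _ 2) ?abs_ge0 //.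
by rewrite !expr2 -!absM mulrNN.
Qed.

Lemma absB x y : v (x - y) = v (y - x). Proof. by rewrite -opprB absN. Qed.

Lemma absX x n : v (x ^+ n) = v x ^+ n.
Proof. by elim: n => [|n IH]; rewrite ?expr0 ?abs1 // !exprS absM IH. Qed.

Lemma abs_sum_le n (F : 'I_n -> K) : v (\sum_i F i) <= \sum_i v (F i).
Proof.
have [_ _ _ vD] := v_abs.
elim/big_ind2: _ => [|x1 x2 y1 y2 h1 h2|//]; first by rewrite abs0.
exact: le_trans (vD _ _) (lerD h1 h2).
Qed.

Hypothesis v_nat : forall n, v n%:R <= 1.

(* |(x + y)^n| <= (n + 1) max(|x|, |y|)^n, so the factor n + 1 disappears after
   taking n-th roots. *)
Lemma abs_add_max x y : v (x + y) <= Num.max (v x) (v y).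
Proof.
set M := Num.max _ _.
have xM : v x <= M by rewrite le_max lexx.
have yM : v y <= M by rewrite le_max lexx orbT.
have M0 : 0 <= M := le_trans (abs_ge0 x) xM.
have [M_eq0|Mn0] := eqVneq M 0.
  have z z' : v z' <= M -> z' = 0 by rewrite M_eq0 => h; apply/eqP;
    rewrite -abs_eq0 eq_le h abs_ge0.
  by rewrite (z x) // (z y) // addr0 abs0.
have Mp : 0 < M by rewrite lt_neqAle eq_sym Mn0.
rewrite -[M]mul1r -ler_pdivrMr //; apply: expr_le_linear_le1.
  by rewrite divr_ge0 ?abs_ge0.
move=> n; rewrite expr_div_n ler_pdivrMr ?exprn_gt0 // -absX exprDn.
rewrite (le_trans (abs_sum_le _)) //.
have -> : n.+1%:R * M ^+ n = \sum_(i < n.+1) M ^+ n.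
  by rewrite sumr_const card_ord mulr_natl.
apply: ler_sum => i _; rewrite -mulr_natr absM absM !absX.
have -> : M ^+ n = M ^+ (n - i) * M ^+ i by rewrite -exprD subnK // -ltnS.
rewrite -[leRHS]mulr1 ler_pM ?mulr_ge0 ?exprn_ge0 ?abs_ge0 //.
by rewrite ler_pM ?exprn_ge0 ?abs_ge0 // lerXn2r ?nnegrE ?abs_ge0.
Qed.

Lemma abs_add_le x y e : v x <= e -> v y <= e -> v (x + y) <= e.
Proof. by move=> xe ye; rewrite (le_trans (abs_add_max _ _)) // ge_max xe. Qed.

Lemma abs_sub_le x y e : v x <= e -> v y <= e -> v (x - y) <= e.
Proof. by move=> xe ye; rewrite abs_add_le ?absN. Qed.

Lemma abs_big_le (I : Type) (r : seq I) (P : pred I) (F : I -> K) e :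
  0 <= e -> (forall i, P i -> v (F i) <= e) -> v (\sum_(i <- r | P i) F i) <= e.
Proof.
move=> e0 Fe; elim/big_ind: _ => [|x y|//]; first by rewrite abs0.
exact: abs_add_le.
Qed.

Lemma abs_eq_of_lt x y : v (x - y) < v x -> v y = v x.
Proof.
move=> h; apply/eqP; rewrite eq_le; apply/andP; split.
  by rewrite -[y](subKr x) abs_sub_le // ltW.
have := abs_add_max (x - y) y; rewrite subrK le_max => /orP[|//].
by rewrite leNgt h.
Qed.

Definition psum (f : nat -> K) z n := \sum_(k < n) f k * z ^+ k.

Definition cauchy_prod (f g : nat -> K) n := \sum_(i < n.+1) f i * g (n - i)%N.

Lemma abs_monom_le c z k : v c <= 1 -> v z <= 1 -> v (c * z ^+ k) <= v z ^+ k.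
Proof. by move=> c1 z1; rewrite absM absX ler_piMl ?exprn_ge0 ?abs_ge0. Qed.

Lemma psum_le1 f z n : (forall k, v (f k) <= 1) -> v z <= 1 -> v (psum f z n) <= 1.
Proof.
move=> f1 z1; apply: abs_big_le => // k _.
by rewrite (le_trans (abs_monom_le _ _ _)) ?exprn_ile1 ?abs_ge0.
Qed.

Lemma psum_sub_le f z m n : (m <= n)%N -> (forall k, (m <= k)%N -> v (f k) <= 1) ->
  v z <= 1 -> v (psum f z n - psum f z m) <= v z ^+ m.
Proof.
move=> mn f1 z1; rewrite /psum -!(big_mkord xpredT (fun k => f k * z ^+ k)).
rewrite (big_cat_nat (n := m)) //= addrAC subrr add0r big_nat_cond.
apply: abs_big_le => [|k /andP[/andP[mk _] _]]; first by rewrite exprn_ge0 ?abs_ge0.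
by rewrite (le_trans (abs_monom_le _ _ _)) ?f1 // ler_wiXn2l ?abs_ge0.
Qed.

(** Below index [n] the product of the two truncations has the coefficients of the Cauchy product,
    and its later ones have absolute value at most 1. Evaluation is thus multiplicative up to a
    controlled error, with no limit taken in [K]. *)
Lemma psum_mul_le f g z n : (forall k, v (f k) <= 1) -> (forall k, v (g k) <= 1) ->
  v z <= 1 -> v (psum f z n * psum g z n - psum (cauchy_prod f g) z n) <= v z ^+ n.
Proof.
move=> f1 g1 z1.
pose q := \poly_(k < n) f k * \poly_(k < n) g k.
have -> : psum f z n * psum g z n = psum (fun k => q`_k) z (n + size q)%N.
  rewrite [RHS](_ : _ = q.[z]); first by rewrite hornerM !horner_poly.
  by rewrite /psum -horner_coef_wide // leq_addl.
have -> : psum (cauchy_prod f g) z n = psum (fun k => q`_k) z n.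
  apply: eq_bigr => k _; congr (_ * _); rewrite coefM; apply: eq_bigr => i _.
  have := ltn_ord i; have := ltn_ord k => kn ik.
  by rewrite !coef_poly !ifT //; lia.
apply: psum_sub_le; rewrite ?leq_addr // => k _.
rewrite coefM; apply: abs_big_le => // i _; rewrite absM mulr_ile1 ?abs_ge0 //.
  by rewrite coef_poly; case: ifP; rewrite ?abs0.
by rewrite coef_poly; case: ifP; rewrite ?abs0.
Qed.

End AbsoluteValue.

(** * Weierstrass preparation and roots of power series *)

Lemma exprn_lt_ex (R : realType) (r e : R) : 0 <= r -> r < 1 -> 0 < e ->
  exists N, r ^+ N < e.
Proof.
move=> r0 r1 e0.
have /cvgrPdist_lt/(_ e e0)[N _ /(_ N (leqnn N))] : (fun n => r ^+ n) @ \oo --> (0 : R).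
  by apply: cvg_expr; rewrite ger0_norm.
by rewrite sub0r normrN ger0_norm ?exprn_ge0 // => ?; exists N.
Qed.

(** Turns estimates that hold up to an error [r ^+ N], for every [N], into exact ones. *)
Lemma le_of_forall_exprn_le (R : realType) (r x y : R) : 0 <= r -> r < 1 ->
  0 <= y -> (forall N, x <= Num.max y (r ^+ N)) -> x <= y.
Proof.
move=> r0 r1 y0 h; rewrite leNgt; apply/negP => yx.
have [N rN] := exprn_lt_ex r0 r1 (le_lt_trans y0 yx).
by have := h N; rewrite le_max !leNgt yx rN.
Qed.

(** * Division and splitting of formal power series over a field *)

Section Convolution.
Variable F : fieldType.
Implicit Types f g h u w : nat -> F.

Lemma cauchy_prod_subl f g h n : cauchy_prod (f - g) h n = cauchy_prod f h n - cauchy_prod g h n.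
Proof.
by rewrite /cauchy_prod -sumrB; apply: eq_bigr => i _; rewrite -mulrBl.
Qed.

Lemma cauchy_prod_rec w u n :
  cauchy_prod w u n = w n * u 0%N + \sum_(i < n) w i * u (n - i)%N.
Proof. by rewrite /cauchy_prod big_ord_recr /= subnn addrC. Qed.

(** The first [n] coefficients of the quotient of the series [h] by [u], kept as a list because each
    one depends on all the earlier ones. *)
Fixpoint solve_seq u h n : seq F :=
  if n is m.+1 then
    let l := solve_seq u h m in
    rcons l ((h m - \sum_(i < m) l`_i * u (m - i)%N) / u 0%N)
  else [::].

Lemma cauchy_prod_solve u h : u 0%N != 0 -> exists w, forall n, cauchy_prod w u n = h n.
Proof.
move=> u0; pose w n := (solve_seq u h n.+1)`_n.
have sz n : size (solve_seq u h n) = n by elim: n => //= n IH; rewrite size_rcons IH.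
have nthE n i : (i < n)%N -> (solve_seq u h n)`_i = w i.
  elim: n => // n IH; rewrite ltnS leq_eqVlt => /predU1P[-> //|i_n] /=.
  by rewrite nth_rcons sz i_n IH.
exists w => n; rewrite cauchy_prod_rec {1}/w /= nth_rcons sz ltnn eqxx divfK //.
by under eq_bigr => i _ do rewrite nthE //; rewrite subrK.
Qed.

(** The coefficient of [g] that multiplies [w i] has index at least [d] exactly when [i <= k]. *)
Lemma cauchy_prod_split w g d k :
  cauchy_prod w g (d + k) = cauchy_prod w (fun i => g (d + i)%N) k
                     + cauchy_prod w (fun i => if (i < d)%N then g i else 0) (d + k).
Proof.
rewrite /cauchy_prod (big_ord_widen (d + k).+1 (fun i => w i * g (d + (k - i))%N));
  last by rewrite ltnS leq_addl.
rewrite [X in _ = X + _]big_mkcond -big_split; apply: eq_bigr => i _ /=.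
have := ltn_ord i; rewrite ltnS => i_dk.
case: ltnP => [ik|ki].
  by rewrite ifF ?mulr0 ?addr0 ?addnBA //; lia.
by rewrite add0r ifT //; lia.
Qed.

End Convolution.

Lemma rmorph_cauchy_prod (F K : fieldType) (phi : {rmorphism F -> K}) f g n :
  phi (cauchy_prod f g n) = cauchy_prod (phi \o f) (phi \o g) n.
Proof. by rewrite rmorph_sum; apply: eq_bigr => i _; rewrite rmorphM. Qed.

Section Weierstrass.
Variables (R : realType) (F : fieldType) (v : F -> R).
Hypotheses (v_abs : is_absolute_value v) (v_nat : forall n, v n%:R <= 1).
Variables (r : R) (g : nat -> F) (d : nat).
Hypotheses (r0 : 0 <= r) (r1 : r < 1) (g_int : forall i, v (g i) <= 1)
  (g_low : forall i, (i < d)%N -> v (g i) <= r) (g_d : v (g d) = 1).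

Lemma cauchy_prod_le w u e c n : 0 <= e -> 0 <= c -> (forall i, v (w i) <= e) ->
  (forall i, (i <= n)%N -> v (u i) <= c) -> v (cauchy_prod w u n) <= e * c.
Proof.
move=> e0 c0 we uc; apply: abs_big_le; rewrite ?mulr_ge0 // => i _.
by rewrite absM // ler_pM ?abs_ge0 ?uc ?leq_subr.
Qed.

(** By induction, since [w k * u 0] is the coefficient of the product minus terms that involve only
    earlier values of [w]. *)
Lemma cauchy_prod_solution_le w u e : v (u 0%N) = 1 -> (forall i, v (u i) <= 1) -> 0 <= e ->
  (forall k, v (cauchy_prod w u k) <= e) -> forall k, v (w k) <= e.
Proof.
move=> u0 u1 e0 he k; elim/ltn_ind: k => k IH.
rewrite -[v _]mulr1 -u0 -absM //.
have /eqP := cauchy_prod_rec w u k; rewrite -subr_eq => /eqP <-.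
rewrite abs_sub_le // abs_big_le // => i _.
by rewrite absM // (le_trans _ (IH i (ltn_ord i))) // ler_piMr ?abs_ge0.
Qed.

(* The inverse w of the unit factor solves the linear system
   (w g)_(d + k) = [k = 0]; splitting g into its coefficients below d, which are
   small, and the rest, which is invertible, it is the limit of a contraction. *)
Lemma weierstrass_approx : exists w : nat -> nat -> F,
  [/\ forall N i, v (w N i) <= 1,
      forall N, v (w N 0%N) = 1,
      forall N i, v (w N.+1 i - w N i) <= r ^+ N
    & forall N k, v (cauchy_prod (w N) g (d + k) - (k == 0%N)%:R) <= r ^+ N].
Proof.
pose u i := g (d + i)%N; pose gl i := if (i < d)%N then g i else 0.
have u0 : v (u 0%N) = 1 by rewrite /u addn0.
have u1 i : v (u i) <= 1 by exact: g_int.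
have glr i : v (gl i) <= r by rewrite /gl; case: ifP => [/g_low//|]; rewrite abs0.
have un0 : u 0%N != 0 by rewrite -(abs_eq0 v_abs) u0 oner_eq0.
pose S h := sval (cid (cauchy_prod_solve h un0)).
have SP h n : cauchy_prod (S h) u n = h n by rewrite /S; case: cid.
(* By [cauchy_prod_split], a fixed point of [step] is a solution of the linear system. *)
pose step w := S (fun k => (k == 0%N)%:R - cauchy_prod w gl (d + k)).
pose w N := iter N step 0.
have wS N k : cauchy_prod (w N.+1) u k = (k == 0%N)%:R - cauchy_prod (w N) gl (d + k).
  exact: SP.
have delta1 k : v (k == 0%N)%:R <= 1 by exact: v_nat.
have w1 N i : v (w N i) <= 1.
  elim: N i => [|N IH]; first by move=> i; rewrite abs0.
  apply: (cauchy_prod_solution_le u0 u1) => // k; rewrite wS abs_sub_le //.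
  rewrite -[leRHS]mulr1; apply: cauchy_prod_le => // i _.
  by rewrite (le_trans (glr i)) // ltW.
have dw N i : v ((w N.+1 - w N) i) <= r ^+ N.
  elim: N i => [|N IH].
    by move=> i; rewrite expr0 abs_sub_le ?w1.
  apply: (cauchy_prod_solution_le u0 u1) => [|k]; first by rewrite exprn_ge0.
  (* The constant term cancels, so the new difference is the old one multiplied by [gl], which
     brings the contraction factor [r]. *)
  have -> : cauchy_prod (w N.+2 - w N.+1) u k = - cauchy_prod (w N.+1 - w N) gl (d + k).
    by rewrite !cauchy_prod_subl !wS; ring.
  by rewrite absN // exprSr; apply: cauchy_prod_le => //; rewrite exprn_ge0.
(* The shift by one discards the starting point 0, whose constant coefficient is not a unit. *)
exists (fun N => w N.+1); split=> [//|N|N i|N k].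
- rewrite -[LHS]mulr1 -{1}u0 -absM //.
  have -> : w N.+1 0%N * u 0%N = cauchy_prod (w N.+1) u 0 by rewrite cauchy_prod_rec big_ord0 addr0.
  (* The value is 1 minus a term of absolute value at most [r < 1]. *)
  rewrite wS -[RHS](abs1 v_abs); apply: abs_eq_of_lt => //.
  rewrite opprB addrC subrK abs1 // (le_lt_trans _ r1) // -[r]mul1r.
  exact: cauchy_prod_le.
- by rewrite (le_trans (dw _ _)) // exprS ler_piMl ?exprn_ge0 // ltW.
- rewrite cauchy_prod_split wS -/gl [X in v X](_ : _ = cauchy_prod (w N.+1 - w N) gl (d + k)).
    rewrite -[leRHS]mulr1; apply: cauchy_prod_le; rewrite ?exprn_ge0 // => i _.
    by rewrite (le_trans (glr i)) // ltW.
  by rewrite cauchy_prod_subl; ring.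
Qed.

End Weierstrass.

Section RootExistence.
Variables (R : realType) (F : fieldType) (K : closedFieldType).
Variables (v : K -> R) (phi : {rmorphism F -> K}) (r : R).
Hypotheses (v_abs : is_absolute_value v) (v_nat : forall n, v n%:R <= 1).
Hypotheses (r0 : 0 <= r) (r1 : r < 1).
Hypothesis v_complete : forall c : nat -> F,
  (forall N, v (phi (c N.+1 - c N)) <= r ^+ N) ->
  exists x, forall N, v (x - phi (c N)) <= r ^+ N.
Variables (g : nat -> F) (d : nat).
Hypotheses (d_gt0 : (0 < d)%N) (g_int : forall i, v (phi (g i)) <= 1)
  (g_low : forall i, (i < d)%N -> v (phi (g i)) <= r) (g_d : v (phi (g d)) = 1)
  (g0 : g 0%N != 0).

(** A root of the Weierstrass polynomial is a root of [g]; the bound on partial sums stands for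
    convergence to 0. Completeness is assumed only along sequences from [F], as an algebraic closure
    of Q_p is not complete; the coefficients of the polynomial are limits of this kind. *)
Lemma power_series_root : exists lambda : K, [/\ lambda != 0, v lambda < 1 &
  forall M, (d < M)%N -> v (psum (phi \o g) lambda M) <= v lambda ^+ M].
Proof.
have phi_abs : is_absolute_value (v \o phi).
  have [v0 v00 vM vD] := v_abs; split=> [x|x|x y|x y] /=; first exact: v0.
  - rewrite v00; split=> [/eqP|->]; last by rewrite rmorph0.
    by rewrite fmorph_eq0 => /eqP.
  - by rewrite rmorphM vM.
  - by rewrite rmorphD vD.
have phi_nat n : (v \o phi) n%:R <= 1 by rewrite /= rmorph_nat.
have [w [w1 w0 dw wg]] := weierstrass_approx phi_abs phi_nat r0 r1 g_int g_low g_d.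
pose c i N := cauchy_prod (w N) g i.
have c_lim i : exists x, forall N, v (x - phi (c i N)) <= r ^+ N.
  apply: v_complete => N; rewrite /c -cauchy_prod_subl -[leRHS]mulr1.
  apply: (cauchy_prod_le phi_abs phi_nat) => // [|j|j _]; [|exact: dw|exact: g_int].
  by rewrite exprn_ge0.
pose x i := sval (cid (c_lim i)).
have xP i N : v (x i - phi (c i N)) <= r ^+ N by rewrite /x; case: cid.
have x_low i : (i < d)%N -> v (x i) <= r.
  (* Precision [N = 1] suffices: the error is at most [r], and so is the approximation, which
     involves only coefficients of [g] below [d]. *)
  move=> id; rewrite -[x i](subrK (phi (c i 1%N))).
  apply: (abs_add_le v_abs v_nat); first by have := xP i 1%N; rewrite expr1.
  rewrite -[r]mul1r; apply: (cauchy_prod_le phi_abs phi_nat ler01 r0) => [|j ji].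
    exact: w1.
  by apply: g_low; exact: leq_ltn_trans ji id.
(* The Weierstrass polynomial: the coefficients of [w N] times [g] tend to [x i] below [d], and to
   1, 0, 0, ... from [d] on. *)
pose P := 'X^d + \poly_(i < d) x i.
have szP : size P = d.+1.
  by rewrite size_polyDl size_polyXn // ltnS size_poly.
have P_low i : (i < d)%N -> P`_i = x i.
  by move=> id; rewrite coefD coefXn coef_poly id ltn_eqF // add0r.
have P_d k : P`_(d + k) = (k == 0%N)%:R.
  by rewrite coefD coefXn coef_poly ltnNge leq_addr addr0 -{2}[d]addn0 eqn_add2l.
have [lambda /rootP Pl] : exists l, root P l.
  by apply/closed_rootP; rewrite szP eqSS -lt0n.
have Psum M : (d < M)%N -> psum (fun k => P`_k) lambda M = 0.
  by move=> dM; rewrite -[RHS]Pl /psum -horner_coef_wide // szP.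
(* Otherwise the lower terms, with coefficients at most [r], could not cancel the leading term
   [lambda ^+ d]. *)
have l1 : v lambda < 1.
  rewrite ltNge; apply/negP => l1.
  have := Psum d.+1 (ltnSn d); rewrite /psum big_ord_recr /= -[X in P`_X]addn0.
  rewrite P_d mul1r => /eqP; rewrite addrC addr_eq0 => /eqP/(congr1 v).
  rewrite absN // absX // => e; suff : v lambda ^+ d <= r * v lambda ^+ d.
    by rewrite ler_pMl ?leNgt ?r1 // exprn_gt0 // (lt_le_trans ltr01).
  rewrite {1}e; apply: abs_big_le => // [|i _].
    by rewrite mulr_ge0 ?exprn_ge0 // abs_ge0.
  rewrite P_low // absM // absX // ler_pM ?x_low ?exprn_ge0 ?(abs_ge0 v_abs) //.
  by rewrite ler_weXn2l // ltnW.
exists lambda; split=> // [|M dM].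
  (* The constant coefficient of [w N] has absolute value 1, so [x 0 = 0] would force [g 0] to be at
     most [r ^+ N] for every [N]. *)
  apply/eqP => l0; have : x 0%N = 0.
    by rewrite -P_low // -horner_coef0; rewrite l0 in Pl.
  move=> x0; have : v (phi (g 0%N)) <= 0.
    apply: (le_of_forall_exprn_le r0 r1) => // N; rewrite le_max; apply/orP; right.
    have := xP 0%N N; rewrite x0 sub0r absN // /c cauchy_prod_rec big_ord0 addr0.
    by rewrite rmorphM absM // [v (phi (w N 0%N))]w0 mul1r.
  by rewrite leNgt abs_gt0 // fmorph_eq0 g0.
(* For each [N], the truncation [B] of [w N] at [lambda] has absolute value 1, [B * A] is within
   [v lambda ^+ M] of [C], and [C] is within [r ^+ N] of [P.[lambda] = 0]. *)
apply: (le_of_forall_exprn_le r0 r1) => [|N]; first by rewrite exprn_ge0 ?abs_ge0.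
have Ml1 := ltW l1.
set A := psum _ _ _; pose B := psum (phi \o w N) lambda M.
have vB : v B = 1.
  have M0 : (0 < M)%N by exact: leq_trans dM.
  have b0 : psum (phi \o w N) lambda 1 = phi (w N 0%N).
    by rewrite /psum big_ord1 expr0 mulr1.
  have w0' : v (phi (w N 0%N)) = 1 by exact: w0.
  rewrite -w0'; apply: abs_eq_of_lt => //; rewrite w0' absB // -b0.
  by rewrite (le_lt_trans (psum_sub_le v_abs v_nat _ _ _)) // => k _; exact: w1.
rewrite -[v A]mul1r -vB -absM // le_max; apply/orP.
pose C := psum (cauchy_prod (phi \o w N) (phi \o g)) lambda M.
have BA : v (B * A - C) <= v lambda ^+ M by apply: psum_mul_le => // k; exact: w1.
have CN : v C <= r ^+ N.
  rewrite -[C]subr0 -(Psum M dM) /C /psum -sumrB; apply: abs_big_le => //.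
    by rewrite exprn_ge0.
  move=> k _; rewrite -mulrBl absM // absX //.
  rewrite -[leRHS]mulr1 ler_pM ?exprn_ge0 ?exprn_ile1 ?(abs_ge0 v_abs) //.
  rewrite -rmorph_cauchy_prod; have [kd|dk] := ltnP k d.
    by rewrite P_low // absB // xP.
  by rewrite -(subnKC dk) P_d -(rmorph_nat phi) -rmorphB wg.
rewrite -[B * A](subrK C); have := abs_add_max v_abs v_nat (B * A - C) C.
rewrite le_max => /orP[h|h]; [left|right]; exact: le_trans h _.
Qed.

End RootExistence.

(** * Liouville inequality and transcendence *)

Section Liouville.
Variables (R : realType) (K : fieldType) (v : K -> R).
Hypotheses (v_abs : is_absolute_value v) (v_nat : forall n, v n%:R <= 1).
Hypothesis v_int_lower : forall n : int, n != 0 -> 1 <= `|n|%:~R * v n%:~R.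
Variables (lambda : K) (lambda_lt1 : v lambda < 1).

Local Notation pK := (map_poly (intr : int -> K)).

Lemma abs_int_le1 (n : int) : v n%:~R <= 1.
Proof.
case: n => n.
  exact: v_nat.
rewrite NegzE mulrNz (absN v_abs). exact: v_nat.
Qed.

Lemma intr_abs_eq0 (n : int) : (n%:~R == 0 :> K) = (n == 0).
Proof.
apply/eqP/eqP => [n0|-> //]; apply/eqP; apply: contraT => /v_int_lower.
by rewrite n0 abs0 // mulr0 ler10.
Qed.

Lemma size_map_intr (q : {poly int}) : size (pK q) = size q.
Proof.
have [->|q0] := eqVneq q 0; first by rewrite map_poly0 !size_poly0.
by apply: size_map_poly_id0; rewrite intr_abs_eq0 lead_coef_eq0.
Qed.

Lemma abs_horner_int_le1 (q : {poly int}) : v (pK q).[lambda] <= 1.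
Proof.
rewrite horner_coef; apply: (psum_le1 v_abs v_nat); last exact: ltW.
by move=> k; rewrite coef_map abs_int_le1.
Qed.

(** Minimality of the degree takes the place of irreducibility in the resultant argument. *)
Lemma minimal_int_poly (m : {poly int}) : m != 0 -> root (pK m) lambda ->
  exists m0 : {poly int}, [/\ m0 != 0, root (pK m0) lambda &
    forall q, q != 0 -> root (pK q) lambda -> (size m0 <= size q)%N].
Proof.
move=> m_neq0 ml.
pose P n := `[< exists q : {poly int}, [/\ q != 0, root (pK q) lambda & size q = n] >].
have exP : exists n, P n by exists (size m); apply/asboolP; exists m.
case: (ex_minnP exP) => n /asboolP[m0 [m00 m0l <-]] min; exists m0; split=> // q q0 ql.
apply: min; apply/asboolP; by exists q.
Qed.

(* Res(m, S) is a nonzero integer of the form U m + V S, so its p-adic absolute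
   value is at most |S(lambda)|, while it is at least the inverse of its
   archimedean one. *)
Lemma liouville (m : {poly int}) : m != 0 -> root (pK m) lambda ->
  exists2 m0 : {poly int}, m0 != 0 & forall S : {poly int}, (1 < size S)%N ->
    (pK S).[lambda] != 0 ->
    1 <= (coef_norm m0)%:~R ^+ (size S).-1 * (coef_norm S)%:~R ^+ (size m0).-1
         * v (pK S).[lambda].
Proof.
move=> m_neq0 ml; have [m0 [m00 m0l m0min]] := minimal_int_poly m_neq0 ml.
exists m0 => // S szS Sl.
have szm0 : (1 < size m0)%N.
  by rewrite -size_map_intr (root_size_gt1 _ m0l) // -size_poly_eq0 size_map_intr size_poly_eq0.
(* A nonconstant common divisor [h] does not vanish at [lambda], because [S] does not; so the
   cofactor of [h] in [m0] would be a smaller polynomial with root [lambda]. Over the integers both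
   divisibilities hold up to nonzero constants. *)
have res0 : resultant m0 S != 0.
  rewrite resultant_eq0 -leqNgt; set h := gcdp m0 S; apply: contraT; rewrite -ltnNge => szh.
  have /Pdiv.Idomain.dvdpP[[c q] /= c0 /(congr1 pK) Se] : (h %| S)%R by exact: dvdp_gcdr.
  have /Pdiv.Idomain.dvdpP[[c' q'] /= c'0 me] : (h %| m0)%R by exact: dvdp_gcdl.
  have hl : (pK h).[lambda] != 0.
    apply: contra_neq Sl => hl; move: Se => /(congr1 (horner^~ lambda)).
    rewrite map_polyZ rmorphM /= hornerZ hornerM hl mulr0 => /eqP.
    by rewrite mulf_eq0 intr_abs_eq0 (negbTE c0) => /eqP.
  have q'0 : q' != 0.
    by apply: contra_neq m00 => q'0; move/eqP: me; rewrite q'0 mul0r scale_poly_eq0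
      (negbTE c'0) => /eqP.
  have q'l : root (pK q') lambda.
    have /(congr1 (fun r => (pK r).[lambda])) := me.
    rewrite map_polyZ rmorphM /= hornerZ hornerM (rootP m0l) mulr0 => /esym/eqP.
    by rewrite mulf_eq0 (negbTE hl) orbF.
  have := m0min _ q'0 q'l; have /(congr1 (fun r => size (polyseq r))) := me.
  have h0 : h != 0 by rewrite -size_poly_gt0 ltnW.
  rewrite size_scale // size_mul // => ->; move: (size q') (size h) szh => x y; lia.
have [[U V] /= [_ _] /(congr1 (fun r => (pK r).[lambda]))] := resultant_in_ideal szm0 szS.
rewrite map_polyC hornerC rmorphD !rmorphM /= hornerD !hornerM (rootP m0l) mulr0 add0r.
move=> resE; apply: le_trans (v_int_lower res0) _.
apply: ler_pM; rewrite ?ler0z ?(abs_ge0 v_abs) //.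
  by rewrite -!rmorphXn -rmorphM /= ler_int resultant_le.
by rewrite resE absM // ler_piMl ?abs_ge0 ?abs_horner_int_le1.
Qed.

(** * Truncations of a lacunary series and their values *)

Variables (a : nat -> int) (b : nat -> nat) (C kappa : R) (M0 : nat).
Hypotheses (lambda_neq0 : lambda != 0) (b_incr : {homo b : m n / (m < n)%N})
  (b0 : (0 < b 0%N)%N) (a_neq0 : forall n, a n != 0)
  (b_fast : forall k, exists N, forall n, (N <= n)%N -> (k * b n <= b n.+1)%N)
  (C1 : 1 < C) (kappa1 : 1 < kappa)
  (a_bound : forall n, `|(a n)%:~R : R| <= kappa * C ^+ b n).

Local Notation f := (lacunary a b).
Local Notation S n := (\poly_(k < (b n).+1) f k).
Local Notation fK := (fun k => (f k)%:~R : K).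

Hypothesis f_small : forall M, (M0 < M)%N -> v (psum fK lambda M) <= v lambda ^+ M.

Lemma lacunary_cases k : f k = 0 \/ exists2 n, b n = k & f k = a n.
Proof.
have [[n bn]|h] := pselect (exists n, b n = k).
  by right; exists n => //; rewrite -bn lacunaryE.
by left; apply: lacunary0 => n; apply/eqP => bn; apply: h; exists n.
Qed.

Lemma lacunary_gap n k : (b n < k < b n.+1)%N -> f k = 0.
Proof.
have bmono i j : (i <= j)%N -> (b i <= b j)%N.
  by rewrite leq_eqVlt => /predU1P[-> //|/b_incr/ltnW].
move=> /andP[nk kn]; apply: lacunary0 => i; apply/eqP => bi.
have [le|le] := leqP i n; first by have := bmono _ _ le; lia.
by have := bmono _ _ le; lia.
Qed.

(** The gap after [b n] lets the truncation be prolonged up to [b n.+1], so that [f_small] bounds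
    its value by [v lambda ^+ b n.+1]. *)
Lemma horner_lacunary_trunc n : (pK (S n)).[lambda] = psum fK lambda (b n.+1).
Proof.
have nb : (b n < b n.+1)%N by exact: b_incr.
rewrite (horner_coef_wide _ (_ : (size (pK (S n)) <= b n.+1)%N)).
  apply: eq_bigr => k _; rewrite coef_map coef_poly; case: ifPn => //.
  rewrite -leqNgt => nk; congr (_ * _); rewrite (@lacunary_gap n) //.
  by rewrite nk ltn_ord.
by rewrite size_map_intr (leq_trans (size_poly _ _)).
Qed.

Lemma size_lacunary_trunc n : size (S n) = (b n).+1.
Proof. by rewrite size_poly_eq //= lacunaryE. Qed.

Lemma lacunary_exponent_gt0 n : (0 < b n)%N.
Proof. by case: n => // n; rewrite (leq_trans b0) // ltnW // b_incr. Qed.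

(** There are [(b n).+1] coefficients, each at most [kappa * C ^+ b n]; the count is at most
    [2 ^ b n], and [kappa <= kappa ^+ b n], which merges everything into one exponential. *)
Lemma coef_norm_lacunary_trunc n :
  (coef_norm (S n))%:~R <= (kappa * 2 * C) ^+ b n :> R.
Proof.
have k0 : 0 < kappa by exact: lt_trans kappa1.
have C0 : 0 < C by exact: lt_trans C1.
rewrite /coef_norm size_lacunary_trunc rmorph_sum /=.
apply: (@le_trans _ _ (\sum_(i < (b n).+1) kappa * C ^+ b n)).
  apply: ler_sum => i _; rewrite coef_poly ltn_ord intr_norm.
  have [->|[j bj ->]] := lacunary_cases i.
    by rewrite normr0 mulr_ge0 ?exprn_ge0 // ltW.
  rewrite (le_trans (a_bound j)) // bj (ler_wpM2l (ltW k0)) //.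
  by rewrite (ler_weXn2l (ltW C1)) // -ltnS.
rewrite sumr_const card_ord -[leLHS]mulr_natl !exprMn.
rewrite [X in _ <= X * _]mulrC -mulrA.
rewrite ler_pM ?mulr_ge0 ?exprn_ge0 ?(ltW k0) ?(ltW C0) //.
  by rewrite -natrX ler_nat ltn_expl.
by rewrite ler_pM ?exprn_ge0 ?(ltW k0) ?(ltW C0) // ler_eXnr ?lacunary_exponent_gt0 // ltW.
Qed.

Lemma lacunary_root_transcendental (m : {poly int}) :
  m != 0 -> ~ root (pK m) lambda.
Proof.
move=> m_neq0 /(liouville m_neq0)[m0 m00 bound].
have x0 : 0 < v lambda by rewrite abs_gt0.
set A : R := (coef_norm m0)%:~R in bound.
have A0 : 0 <= A by rewrite ler0z sumr_ge0.
pose E := A * (kappa * 2 * C) ^+ (size m0).-1.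
have kC0 : 0 <= kappa * 2 * C by rewrite !mulr_ge0 // ltW // (lt_trans ltr01).
have E0 : 0 <= E by rewrite mulr_ge0 // exprn_ge0.
have bnd n : (M0 < b n.+1)%N -> (pK (S n)).[lambda] != 0 ->
    1 <= E ^+ b n * v lambda ^+ b n.+1.
  move=> nM nz; apply: le_trans (bound _ _ nz) _.
    by rewrite size_lacunary_trunc ltnS lacunary_exponent_gt0.
  rewrite size_lacunary_trunc /= /E exprMn; apply: ler_pM => //.
  - by rewrite mulr_ge0 ?exprn_ge0 // ler0z sumr_ge0.
  - exact: abs_ge0.
  - rewrite ler_wpM2l ?exprn_ge0 // exprAC lerXn2r ?nnegrE ?exprn_ge0 //.
      by rewrite ler0z sumr_ge0.
    exact: coef_norm_lacunary_trunc.
  - by rewrite horner_lacunary_trunc f_small.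
(* The use of [E + 1] avoids dividing by [E], known only to be nonnegative. *)
have [k xk] : exists k, E * v lambda ^+ k < 1.
  have E1 : 0 < E + 1 by rewrite ltr_wpDl.
  have Ei : 0 < (E + 1)^-1 by rewrite invr_gt0.
  have [k xk] := exprn_lt_ex (ltW x0) lambda_lt1 Ei; exists k.
  move: xk; rewrite -(ltr_pM2l E1) mulfV ?gt_eqF // mulrDl mul1r.
  by apply: le_lt_trans; rewrite lerDl exprn_ge0 // ltW.
have [N0 fast] := b_fast k.
have zero n : (N0 <= n)%N -> (M0 < b n.+1)%N -> (pK (S n)).[lambda] = 0.
  move=> Nn Mn; apply/eqP; apply: contraT => /(bnd n Mn).
  rewrite leNgt; apply: contraNT => _.
  (* Once [b n.+1] is at least [k * b n], the Liouville bound is at most a positive power of a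
     number below 1. *)
  apply: (@le_lt_trans _ _ ((E * v lambda ^+ k) ^+ b n)).
    rewrite [leRHS]exprMn -exprM ler_wpM2l ?exprn_ge0 //.
    by rewrite ler_wiXn2l ?(ltW x0) ?(ltW lambda_lt1) // fast.
  by rewrite exprn_ilt1 ?mulr_ge0 ?exprn_ge0 ?(ltW x0) // -lt0n lacunary_exponent_gt0.
have ge_b n : (n <= b n)%N.
  by elim: n => // n /leq_ltn_trans; apply; exact: b_incr.
pose n := maxn N0 M0.
have Nn : (N0 <= n)%N by rewrite leq_maxl.
have Mn : (M0 < b n.+1)%N by rewrite (leq_trans _ (ge_b n.+1)) // ltnS leq_maxr.
have Mn1 : (M0 < b n.+2)%N by rewrite (ltn_trans Mn) // b_incr.
have := zero n.+1 (leqW Nn) Mn1.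
(* Stopping right after the exponent [b n.+1] isolates the last monomial; the terms before it sum to
   the value of [S n], also zero. *)
have -> : (pK (S n.+1)).[lambda] = psum fK lambda (b n.+1).+1.
  rewrite (horner_coef_wide _ (_ : (size (pK (S n.+1)) <= (b n.+1).+1)%N)).
    by apply: eq_bigr => i _; rewrite coef_map coef_poly ltn_ord.
  by rewrite size_map_intr size_poly.
rewrite /psum big_ord_recr /= -[X in X + _]/(psum fK lambda (b n.+1)).
rewrite -horner_lacunary_trunc zero // add0r lacunaryE // => /eqP.
by rewrite mulf_eq0 intr_abs_eq0 (negbTE (a_neq0 _)) expf_eq0 (negbTE lambda_neq0) andbF.
Qed.

End Liouville.

(** * Roots of unit multiples and p-adic completeness *)

(** A unit of the ring of integer power series takes values of absolute value 1 on the open unit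
    disc, so the smallness of [f] at [lambda] passes to [P]. *)
Lemma root_of_unit_factorization (R : realType) (K : fieldType) (v : K -> R)
    (v_abs : is_absolute_value v) (v_nat : forall n, v n%:R <= 1)
    (lambda : K) (f u : nat -> int) (P : {poly int}) (M0 : nat) :
  v lambda < 1 ->
  (forall M, (M0 < M)%N ->
    v (psum (fun k => (f k)%:~R) lambda M) <= v lambda ^+ M) ->
  ps_unit u -> f = ps_mul (ps_poly P) u -> root (map_poly intr P) lambda.
Proof.
move=> l1 f_small [w uw] fE.
have int1 (h : nat -> int) k : v (h k)%:~R <= 1 by exact: abs_int_le1.
have ps_mulE (g h : nat -> int) k :
    (ps_mul g h k)%:~R = cauchy_prod (fun i => (g i)%:~R) (fun i => (h i)%:~R) k :> K.
  by rewrite rmorph_sum; apply: eq_bigr => i _; rewrite rmorphM.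
have psum_mul g h M : v (psum (fun i => (g i)%:~R) lambda M *
    psum (fun i => (h i)%:~R) lambda M -
    psum (fun i => (ps_mul g h i)%:~R) lambda M) <= v lambda ^+ M.
  rewrite [X in _ - X](eq_bigr (fun k => cauchy_prod (fun i => (g i)%:~R)
    (fun i => (h i)%:~R) (nat_of_ord k) * lambda ^+ k)).
    by apply: psum_mul_le => //; exact: ltW.
  by move=> k _; rewrite ps_mulE.
rewrite /root -(abs_eq0 v_abs) eq_le abs_ge0 // andbT.
apply: (le_of_forall_exprn_le (abs_ge0 v_abs lambda) l1) => // N.
rewrite le_max; apply/orP; right.
(* Large enough for the precision [N], for [f_small], and for the truncation to contain all of
   [P]. *)
pose M := maxn N (maxn M0.+1 (size P)).
have NM : (N <= M)%N by rewrite leq_maxl.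
have M0M : (M0 < M)%N by rewrite !leq_max ltnSn orbT.
have PM : (size P <= M)%N by rewrite !leq_max leqnn !orbT.
apply: (@le_trans _ _ (v lambda ^+ M)); last first.
  by rewrite ler_wiXn2l ?(ltW l1) ?(abs_ge0 v_abs).
have -> : (map_poly intr P).[lambda] = psum (fun i => (ps_poly P i)%:~R) lambda M.
  rewrite (horner_coef_wide _ (leq_trans (size_poly _ _) PM)).
  by apply: eq_bigr => i _; rewrite coef_map.
set A := psum _ _ _; pose U := psum (fun i => (u i)%:~R) lambda M.
have vU : v U = 1.
  pose W := psum (fun i => (w i)%:~R) lambda M.
  have U1 : v U <= 1 by apply: psum_le1 => //; exact: ltW.
  have W1 : v W <= 1 by apply: psum_le1 => //; exact: ltW.
  have one : psum (fun i => (ps_one i)%:~R) lambda M = 1.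
    rewrite -(prednK (leq_ltn_trans (leq0n _) M0M)) /psum big_ord_recl /= expr0 mulr1.
    by rewrite big1 ?addr0 // => i _; rewrite mul0r.
  have UW : v (U * W) = 1.
    rewrite -(abs1 v_abs); apply: (abs_eq_of_lt v_abs v_nat).
    rewrite (absB v_abs) (abs1 v_abs); have := psum_mul u w M; rewrite uw one.
    by move=> h; rewrite (le_lt_trans h) // exprn_ilt1 ?(abs_ge0 v_abs) // -lt0n
      (leq_ltn_trans (leq0n _) M0M).
  (* Both factors of [U * W] are at most 1 in absolute value and their product is 1. *)
  apply/eqP; rewrite eq_le U1 /= -UW absM // ler_piMr ?abs_ge0 //.
rewrite -[v A]mulr1 -vU -absM //.
have := psum_mul (ps_poly P) u M; rewrite -fE -/A -/U => h.
rewrite -[A * U](subrK (psum (fun i => (f i)%:~R) lambda M)).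
by rewrite abs_add_le ?f_small.
Qed.

(** * Rational numbers inside Q_p and limits of rational sequences *)

Section Padic.
Variables (R : realType) (p : nat) (p_pr : prime p).

Lemma padic_norm_int (m : int) : m != 0 ->
  padic_norm p m%:~R = p%:R ^- logn p `|m|.
Proof.
move=> m0; have := padic_norm_frac p_pr m0 (oner_neq0 int).
by rewrite divr1 => ->; rewrite logn1 sub0r -exprnN.
Qed.

Lemma const_cauchy (q : rat) : (fun=> q) \in padic_cauchy_mem p_pr.
Proof. by apply/asboolP => e e0; exists 0%N => m n _ _; rewrite subrr padic_norm0. Qed.

Definition const_seq (q : rat) : cauchy_seq p_pr := CauchySeq (const_cauchy q).

Lemma const_seq_is_zmod_morphism : zmod_morphism const_seq.
Proof. by move=> x y; apply: val_inj. Qed.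

Lemma const_seq_is_monoid_morphism : monoid_morphism const_seq.
Proof. by split=> [|x y]; apply: val_inj. Qed.

HB.instance Definition _ :=
  GRing.isZmodMorphism.Build rat (cauchy_seq p_pr) const_seq const_seq_is_zmod_morphism.
HB.instance Definition _ :=
  GRing.isMonoidMorphism.Build rat (cauchy_seq p_pr) const_seq const_seq_is_monoid_morphism.

(** The sequence [c] is itself Cauchy, so its class is the limit, and the ultrametric bounds on its
    tails pass to [Qp_norm]. *)
Lemma Qp_complete (c : nat -> rat) :
  (forall N, padic_norm p (c N.+1 - c N) <= p%:R^-1 ^+ N) ->
  exists x : Qp p_pr, forall N,
    Qp_norm R (x - Qp_of p_pr (const_seq (c N))) <= p%:R^-1 ^+ N.
Proof.
move=> dc.
have p1 : 1 < (p%:R : rat) by rewrite ltr1n prime_gt1.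
have r0 : 0 <= (p%:R^-1 : rat) by rewrite invr_ge0 ler0n.
have r1 : (p%:R^-1 : rat) < 1 by rewrite invf_lt1 // (lt_trans ltr01).
have dc' N n : (N <= n)%N -> padic_norm p (c n - c N) <= p%:R^-1 ^+ N.
  elim: n => [|n IH].
    rewrite leqn0 => /eqP->.
    by rewrite subrr padic_norm0 exprn_ge0.
  rewrite leq_eqVlt => /predU1P[->|Nn]; first by rewrite subrr padic_norm0 exprn_ge0.
  rewrite -[c n.+1](subrK (c n)) -addrA (le_trans (padic_normD p_pr _ _)) // ge_max IH //.
  by rewrite andbT (le_trans (dc n)) // ler_wiXn2l // ltW.
have cc : c \in padic_cauchy_mem p_pr.
  apply/asboolP => e e0.
  have [N rN] : exists N, (p%:R^-1 : rat) ^+ N < e.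
    have q0 : 0 <= ratr p%:R^-1 :> R by rewrite ler0q.
    have q1 : ratr p%:R^-1 < 1 :> R by rewrite -(rmorph1 (@ratr R)) ltr_rat.
    have e0' : 0 < ratr e :> R by rewrite ltr0q.
    have [N] := exprn_lt_ex q0 q1 e0'.
    by rewrite -rmorphXn ltr_rat => ?; exists N.
  exists N => m n Nm Nn; rewrite (le_lt_trans _ rN) //.
  rewrite -[c m](subrK (c N)) -addrA (le_trans (padic_normD p_pr _ _)) // ge_max dc' //.
  by rewrite padic_normB // dc'.
exists (Qp_of p_pr (CauchySeq cc)) => N.
rewrite -rmorphB; apply: (cvgr_to_le (@Qp_norm_cvg R p p_pr _)).
exists N => // n /= Nn.
have -> : (p%:R^-1 : R) ^+ N = ratr (p%:R^-1 ^+ N) by rewrite rmorphXn fmorphV rmorph_nat.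
by rewrite ler_rat; exact: dc'.
Qed.

End Padic.

Lemma super_exponential_mul_le (R : realType) (b : nat -> nat) :
  (forall n, (0 < b n)%N) -> super_exponential R b ->
  forall k, exists N, forall n, (N <= n)%N -> (k * b n <= b n.+1)%N.
Proof.
move=> b_gt0 /cvgryPge h k; have [N _ hN] := h k%:R; exists N => n /hN /=.
by rewrite ler_pdivlMr ?ltr0n // -natrM ler_nat.
Qed.

Theorem theorem1p3 (R : realType) (p : nat) (p_pr : prime p)
    (* K is an algebraic closure of Q_p, absK the extension to K of |.|_p *)
    (K : closedFieldType) (iota : {rmorphism Qp p_pr -> K})
    (K_algebraic : forall z : K, algebraicOver iota z)
    (absK : K -> R) (absK_val : is_absolute_value absK)
    (absK_ext : forall x : Qp p_pr, absK (iota x) = Qp_norm R x)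
    (b : nat -> nat) (b_incr : {homo b : m n / (m < n)%N})
    (b0 : b 0%N = 1%N) (b_superexp : super_exponential R b)
    (a : nat -> int) (a_neq0 : forall n, a n != 0)
    (p_dvd_a0 : (p%:Z %| a 0%N)%Z)
    (p_ndvd_a : exists i : nat, (1 <= i)%N /\ ~~ (p%:Z %| a i)%Z)
    (a_bound : exists C kappa : R, [/\ 1 < C, 1 < kappa &
      forall n, `|(a n)%:~R : R| <= kappa * C ^+ b n]) :
  (exists lambda : K, ps_root absK (lacunary a b) lambda /\ transcendental lambda)
  /\ ~ (exists (P : {poly int}) (u : nat -> int),
          ps_unit u /\ lacunary a b = ps_mul (ps_poly P) u).
Proof.
pose phi : {rmorphism rat -> K} := iota \o (Qp_of p_pr \o const_seq p_pr).
have phi_rat q : phi q = ratr q by exact: fmorph_eq_rat.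
have abs_phi q : absK (phi q) = ratr (padic_norm p q).
  by rewrite phi_rat -(fmorph_rat iota) absK_ext Qp_norm_rat.
have abs_int (m : int) : m != 0 -> absK m%:~R = p%:R^-1 ^+ logn p `|m|.
  move=> m0; rewrite -(rmorph_int phi) abs_phi padic_norm_int //.
  by rewrite fmorphV rmorphXn rmorph_nat exprVn.
have p1 : 1 < (p%:R : R) by rewrite ltr1n prime_gt1.
have p0 : 0 < (p%:R : R) by exact: lt_trans p1.
have r0 : 0 <= (p%:R^-1 : R) by rewrite invr_ge0 ltW.
have r1 : (p%:R^-1 : R) < 1 by rewrite invf_lt1.
have abs_int1 (m : int) : absK m%:~R <= 1.
  have [->|m0] := eqVneq m 0; first by rewrite abs0.
  by rewrite abs_int // exprn_ile1 // ltW.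
have abs_nat n : absK n%:R <= 1 by rewrite pmulrn.
(* The power of [p] that is the inverse of the p-adic absolute value of [m] divides [m]. *)
have abs_lower (m : int) : m != 0 -> 1 <= `|m|%:~R * absK m%:~R.
  move=> m0; rewrite abs_int // exprVn ler_pdivlMr ?exprn_gt0 // mul1r.
  by rewrite -abszE -pmulrn -natrX ler_nat dvdn_leq ?absz_gt0 // pfactor_dvdnn.
have complete (c : nat -> rat) :
    (forall N, absK (phi (c N.+1 - c N)) <= p%:R^-1 ^+ N) ->
    exists x, forall N, absK (x - phi (c N)) <= p%:R^-1 ^+ N.
  move=> dc; have [|x xc] := @Qp_complete R p p_pr c.
    move=> N; have := dc N; rewrite abs_phi -(ler_rat R).
    by rewrite rmorphXn fmorphV rmorph_nat.
  exists (iota x) => N.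
  rewrite -[phi (c N)]/(iota (Qp_of p_pr (const_seq p_pr (c N)))) -rmorphB absK_ext.
  exact: xc.
have [C [kappa [C1 kappa1 bound]]] := a_bound.
have b_gt0 n : (0 < b n)%N by apply: lacunary_exponent_gt0; rewrite // b0.
have b_fast := super_exponential_mul_le b_gt0 b_superexp.
set f := lacunary a b.
have f0 : f 0%N = 0 by apply: lacunary0 => n; rewrite gtn_eqF.
have [m [m_gt0 pm] m_min] : exists2 m, (1 <= m)%N /\ ~~ (p%:Z %| a m)%Z &
    forall j, (j < m)%N -> (p%:Z %| a j)%Z.
  have exm : exists i, (1 <= i)%N && ~~ (p%:Z %| a i)%Z.
    by have [i [i1 pi]] := p_ndvd_a; exists i; rewrite i1.
  (* Index 0 is covered by the divisibility of [a 0], the other indices by minimality. *)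
  case: (ex_minnP exm) => m /andP[m1 pm] min; exists m => // -[//|j] jm.
  by apply: contraTT jm => pj; rewrite -leqNgt min.
(* Dividing [f] by [x] makes the constant coefficient [a 0], which is nonzero, so that the root
   found is nonzero; [d] is the new position of [a m]. *)
pose g i : rat := (f i.+1)%:~R; pose d := (b m).-1.
have bm : (1 < b m)%N by rewrite -b0 b_incr.
have dE : d.+1 = b m by rewrite prednK // ltnW.
have d_gt0 : (0 < d)%N by rewrite -ltnS dE.
have phi_g i : phi (g i) = (f i.+1)%:~R by rewrite rmorph_int.
have g_int i : absK (phi (g i)) <= 1 by rewrite phi_g.
have g_low i : (i < d)%N -> absK (phi (g i)) <= p%:R^-1.
  rewrite -ltnS dE phi_g /f => i_bm.
  have [->|[j bj ->]] := lacunary_cases a b_incr i.+1; first by rewrite abs0.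
  have jm : (j < m)%N.
    rewrite ltnNge; apply/negP; rewrite leq_eqVlt => /predU1P[mj|/b_incr].
      by move: i_bm; rewrite mj bj ltnn.
    by rewrite bj => /(ltn_trans i_bm); rewrite ltnn.
  rewrite abs_int // -[leRHS]expr1 ler_wiXn2l ?(ltW r1) //.
  have := m_min j jm; rewrite dvdzE /= => pj.
  by rewrite -pfactor_dvdn // absz_gt0.
have g_d : absK (phi (g d)) = 1.
  rewrite phi_g dE /f lacunaryE // abs_int // (_ : logn _ _ = 0%N) //.
  apply/eqP; rewrite -leqn0 leqNgt; apply: contra pm => lg.
  by rewrite dvdzE /= -[p]expn1 pfactor_dvdn // absz_gt0.
have g0 : g 0%N != 0 by rewrite /g -b0 /f lacunaryE // intr_eq0.
have [lambda [l0 l1 small]] :=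
  power_series_root absK_val abs_nat r0 r1 complete d_gt0 g_int g_low g_d g0.
pose fK k : K := (f k)%:~R.
have f_small M : (d.+1 < M)%N -> absK (psum fK lambda M) <= absK lambda ^+ M.
  case: M => // M; rewrite ltnS => dM.
  have -> : psum fK lambda M.+1 = lambda * psum (phi \o g) lambda M.
    rewrite /psum big_ord_recl {1}/fK f0 mul0r add0r mulr_sumr.
    apply: eq_bigr => i _; rewrite -[(phi \o g) i]/(phi (g i)) phi_g lift0 exprS; ring.
  by rewrite absM // exprS ler_wpM2l ?abs_ge0 ?small.
have no_int_poly (q : {poly int}) : q != 0 -> ~ root (map_poly intr q) lambda.
  by apply: (lacunary_root_transcendental absK_val abs_nat abs_lower l1 l0 b_incr
    (b_gt0 0%N) a_neq0 b_fast C1 kappa1 bound f_small).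
split.
  exists lambda; split.
    split=> //; rewrite /ps_converges.
    have lM : (fun n => absK lambda ^+ n) @ \oo --> (0 : R).
      by apply: cvg_expr; rewrite ger0_norm ?abs_ge0.
    apply: (squeeze_cvgr _ (cvg_cst (0 : R)) lM).
    exists d.+2 => // n /= dn; rewrite subr0 abs_ge0 //=.
    exact: f_small.
  (* Clearing denominators reduces algebraicity over the rationals to integer polynomials. *)
  move=> [P P0]; have [q [c c0 PE]] := rat_poly_scale P.
  have q0 : q != 0 by apply: contra_neq P0 => q0; rewrite PE q0 map_poly0 scaler0.
  have -> : map_poly (ratr : rat -> K) P = map_poly phi P.
    by apply: eq_map_poly => x; rewrite -phi_rat.
  rewrite PE map_polyZ rootZ ?fmorph_eq0 ?invr_eq0 ?intr_eq0 // -map_poly_comp.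
  have -> : map_poly (phi \o intr) q = map_poly intr q.
    by apply: eq_map_poly => x /=; exact: (rmorph_int phi).
  exact: no_int_poly.
move=> [P [u [u_unit fE]]].
apply: (no_int_poly P); last first.
  exact: (root_of_unit_factorization absK_val abs_nat l1 f_small u_unit fE).
(* With [P = 0] the product would be zero, against [a 0 != 0]. *)
apply/eqP => P0; have := a_neq0 0%N; rewrite -(lacunaryE a b_incr) -/f fE P0.
by rewrite /ps_mul big1 ?eqxx // => i _; rewrite /ps_poly coef0 mul0r.
Qed.
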